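(* Let $G$ be a graph with more than one edge, let $f:G\to G$ be a vertex map with linearization $L_f:G\to G$, and let $M(L_f)$ be its Markov matrix. If $M(L_f)$ is primitive, then $L_f$ is topologically mixing.
   Context: Graph: a connected space $G$ that is a union of finitely many vertices and finitely many edges $E_1,\dots,E_e$. Each edge is homeomorphic to $[0,1]$, its two boundary points are distinct vertices (no loops), no vertex is an interior point of an edge, and two distinct edges intersect in the empty set, one vertex or two vertices (so several edges may join the same two vertices). Each edge is given unit length via a fixed homeomorphism with $[0,1]$; a path of $m$ edges has length $m$. Vertex map: a continuous map $f:G\to G$ that permutes the vertices of $G$. Linearization: $L_f:G\to G$ agrees with $f$ on vertices, and for each edge $E_i$ with endpoints $V_1,V_2$, $L_f$ maps $E_i$ linearly (i.e. at constant speed with respect to edge length) onto the unique reduced (no backtracking) edge path from $f(V_1)$ to $f(V_2)$ that is homotopic to $f|_{E_i}$ relative to the endpoints of $E_i$. Markov matrix: $M=M(L_f)$ is the $e\times e$ matrix whose entry $M_{i,j}$ is the number of closed subintervals of $E_j$ that $L_f$ maps homeomorphically onto $E_i$ (equivalently, the number of times the edge path $L_f(E_j)$ traverses $E_i$). A non-negative square matrix $M$ is primitive if there is a positive integer $N$ such that for every $k\ge N$ every entry of $M^k$ is positive. A continuous map $g:X\to X$ of a compact space is topologically mixing if for every pair of non-empty open sets $U,V\subseteq X$ there is a positive integer $N$ such that $g^k(U)\cap V\neq\emptyset$ for every $k\ge N$. *)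

(* Defs.v *)
From HB Require Import structures.
From mathcomp Require Import all_boot all_order all_algebra.
From mathcomp Require Import finmap.
From mathcomp Require Import all_classical all_reals all_analysis.

Set Implicit Arguments.
Unset Strict Implicit.
Unset Printing Implicit Defensive.

Import Order.TTheory GRing.Theory Num.Theory.
Import numFieldNormedType.Exports.

Local Open Scope classical_set_scope.
Local Open Scope ring_scope.

Definition unit_interval (R : realType) : set R := `[0, 1]%classic.
Arguments unit_interval R _ : clear implicits.

Definition homeo_onto (S T : topologicalType) (A : set S) (B : set T)
    (f : S -> T) : Prop :=
  [/\ set_bij A B f, {within A, continuous f} &
      exists g : T -> S,
        {within B, continuous g} /\ forall x, A x -> g (f x) = x].

(** [chart i] is the fixed homeomorphism from [0, 1] to the [i]-th edge; its
    values outside [0, 1] are irrelevant. The Hausdorff condition rules out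
    exotic topologies on the union: with it, the topology of [G] is the one
    obtained by gluing the edges at the vertices, and [G] is compact. *)
Record topgraph (R : realType) (G : topologicalType) (e : nat) := TopGraph {
  vertices : set G;
  chart : 'I_e -> R -> G;
  edge := fun i : 'I_e => chart i @` unit_interval R;
  vertices_finite : finite_set vertices;
  chart_homeo : forall i, homeo_onto (unit_interval R) (edge i) (chart i);
  edge_ends : forall i, [/\ vertices (chart i 0), vertices (chart i 1)
                          & chart i 0 <> chart i 1];
  edge_interior : forall (i : 'I_e) (t : R), 0 < t < 1 -> ~ vertices (chart i t);
  edge_meet : forall i j : 'I_e, i != j ->
    [\/ edge i `&` edge j = set0,
        exists2 v, vertices v & edge i `&` edge j = [set v] |
        exists v w, [/\ vertices v, vertices w
                      & edge i `&` edge j = [set v; w]]];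
  graph_cover : vertices `|` \bigcup_i edge i = [set: G];
  graph_hausdorff : hausdorff_space G;
  graph_connected : connected [set: G]
}.

Section Graph.
Variables (R : realType) (G : topologicalType) (e : nat).
Variable X : topgraph R G e.

Definition vertex_map (f : G -> G) : Prop :=
  continuous f /\ set_bij (vertices X) (vertices X) f.

(** [(i, false)] is the edge [i] traversed from [chart X i 0] to
    [chart X i 1]; [(i, true)] is the same edge traversed backwards. *)
Definition dart := ('I_e * bool)%type.

Definition dart_at (d : dart) (s : R) : G :=
  chart X d.1 (if d.2 then 1 - s else s).

Fixpoint edge_path (x : G) (p : seq dart) (y : G) : Prop :=
  if p is d :: p' then dart_at d 0 = x /\ edge_path (dart_at d 1) p' y
  else x = y.

Definition reduced (p : seq dart) : bool :=
  sorted (fun d d' : dart => d' != (d.1, ~~ d.2)) p.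

(** The point reached after travelling a distance [s] along [p] from [x]. *)
Fixpoint travel (x : G) (p : seq dart) (s : R) : G :=
  if p is d :: p' then
    if s <= 1 then dart_at d s else travel (dart_at d 1) p' (s - 1)
  else x.

Definition constant_speed (x : G) (p : seq dart) (t : R) : G :=
  travel x p ((size p)%:R * t).

Definition homotopic_rel_ends (a b : R -> G) : Prop :=
  exists H : R * R -> G,
    [/\ {within unit_interval R `*` unit_interval R, continuous H},
        forall t, unit_interval R t -> H (0, t) = a t /\ H (1, t) = b t &
        forall s, unit_interval R s -> H (s, 0) = a 0 /\ H (s, 1) = a 1].

(** "[L] is the linearization of [f]": for each edge, the reduced path [p] is
    unique, so these conditions determine [L]. *)
Definition linearization (f L : G -> G) : Prop :=
  (forall v, vertices X v -> L v = f v) /\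
  forall i : 'I_e, exists p : seq dart,
    let x := f (chart X i 0) in
    [/\ edge_path x p (f (chart X i 1)),
        reduced p,
        homotopic_rel_ends (f \o chart X i) (constant_speed x p) &
        forall t, unit_interval R t ->
          L (chart X i t) = constant_speed x p t].

(** A closed subinterval of the edge [j] is encoded by the parameters of its
    ends. *)
Definition covering_subintervals (L : G -> G) (i j : 'I_e) : set (R * R) :=
  [set ab | [/\ 0 <= ab.1, ab.1 < ab.2, ab.2 <= 1 &
     homeo_onto (chart X j @` `[ab.1, ab.2]%classic) (edge X i) L]].

(** When [L] is a linearization, the sets counted here are finite. *)
Definition markov_matrix (L : G -> G) : 'M[nat]_e :=
  \matrix_(i, j) #|` fset_set (covering_subintervals L i j)|%fset.

End Graph.

Definition primitive (n : nat) (M : 'M[nat]_n) : Prop :=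
  exists2 N : nat, (0 < N)%N &
    forall k, (N <= k)%N -> forall i j, (0 < (M ^+ k) i j)%N.

Definition topologically_mixing (X : topologicalType) (g : X -> X) : Prop :=
  forall U V : set X, open U -> open V -> U !=set0 -> V !=set0 ->
    exists2 N : nat, (0 < N)%N &
      forall k, (N <= k)%N -> (iter k g @` U) `&` V !=set0.

(* Main.v *)
Require Import Defs.
From mathcomp Require Import all_boot all_order all_algebra.
From mathcomp Require Import all_classical all_reals all_analysis.
From mathcomp Require Import finmap ring lra.

(** For every [n], each edge is tiled by subintervals that [L ^ n] maps affinely
    onto a single edge, with inverse slope of absolute value 1 or at most 1/2.
    Slope 1 means that the subinterval is the whole edge, so that the image of
    the edge is one edge; this is impossible when [M ^ n] is positive and there
    are two edges. Hence the tiles of [L ^ (q * N)] have length at most [2 ^- q],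
    so some tile fits in any given nonempty open set, whose image therefore
    contains an edge; positivity of [M ^ k] spreads this edge over the graph. *)

Import Order.TTheory GRing.Theory Num.Theory.
Import numFieldNormedType.Exports.

Section Mixing.
Local Set Implicit Arguments.
Local Unset Strict Implicit.
Local Open Scope classical_set_scope.
Local Open Scope ring_scope.

Lemma nat_interval_cover (R : realType) (m : nat) (x : R) :
  (0 < m)%N -> 0 <= x <= m%:R ->
  exists2 k, (k < m)%N & 0 <= x - k%:R <= 1.
Proof.
case: m => // m _; elim: m => [|m IHm] /andP[x0 xm].
  by exists 0%N; rewrite // subr0 x0.
have [xle|xgt] := leP x m.+1%:R.
  have [|k km kx] := IHm; first by rewrite x0.
  by exists k => //; exact: ltnW.
exists m.+1; first exact: ltnSn.
by rewrite subr_ge0 (ltW xgt) /= lerBlDl natr1.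
Qed.

(** [c + r * s] is a convex combination of [c] and [c + r]. *)
Lemma convex_unit (R : realType) (c r s : R) :
  0 <= c <= 1 -> 0 <= c + r <= 1 -> 0 <= s <= 1 -> 0 <= c + r * s <= 1.
Proof. by move=> /andP[? ?] /andP[? ?] /andP[? ?]; apply/andP; split; nra. Qed.

Variables (R : realType) (G : topologicalType) (e : nat).
Variable X : topgraph R G e.

Lemma travel_nat (p : seq (dart e)) (x y : G) (d0 : dart e) (k : nat) (s : R) :
  edge_path X x p y -> (k < size p)%N -> 0 <= s <= 1 ->
  travel X x p (k%:R + s) = dart_at X (nth d0 p k) s.
Proof.
elim: p x k => // d p IHp x [|k] [_ dp] /= kp /andP[s0 s1].
  by rewrite add0r s1.
have -> : k.+1%:R + s - 1 = k%:R + s by rewrite -natr1; lra.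
(* [travel] assigns a junction to the earlier dart, so its first branch occurs only for [k = 0] and
   [s = 0], where the end of [d] is the start of the next dart. *)
case: ifPn => [ks|_]; last by apply: IHp; rewrite ?s0.
have k0 : (0 : R) <= k%:R by [].
have {}ks : k%:R + s <= 0 by move: ks; rewrite -natr1; lra.
have s_eq0 : s = 0 by lra.
have /eqP : (k%:R : R) = 0 by lra.
rewrite pnatr_eq0 => /eqP k_eq0; move: kp dp.
by rewrite k_eq0 s_eq0 -natr1 add0r addr0; case: p {IHp} => //= d' p _ [].
Qed.

(** Connectedness excludes isolated vertices: the union is nonempty, open because its complement is
    a finite set of vertices, and closed as a finite union of compact sets in a Hausdorff space. *)
Lemma bigcup_edge : (0 < e)%N -> \bigcup_i edge X i = setT.
Proof.
move=> e0; apply: (graph_connected X).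
- exists (chart X (Ordinal e0) 0), (Ordinal e0) => //.
  by exists 0 => //; rewrite /unit_interval /= in_itv /= lexx ler01.
- exists (~` (vertices X `\` \bigcup_i edge X i)).
    apply: closed_openC; apply: compact_closed; first exact: graph_hausdorff X.
    apply: finite_compact.
    exact: sub_finite_set (@subDsetl _ _ _) (vertices_finite X).
  rewrite setTI; apply/seteqP; split=> [x xE [_ //]|x xV].
  have : setT x by [].
  rewrite -(graph_cover X) => -[xv|//].
  by apply: contrapT => xE; exact: xV.
- exists (\bigcup_i edge X i); last by rewrite setTI.
  apply: closed_bigcup => [|i _]; first exact: finite_finset.
  apply: compact_closed; first exact: graph_hausdorff X.
  apply: continuous_compact; last exact: segment_compact.
  by have [_ ] := chart_homeo X i.
Qed.

(** Distinct edges meet only in vertices, and the midpoint of an edge is not a vertex. *)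
Lemma edge_subset (i j : 'I_e) : edge X i `<=` edge X j -> i = j.
Proof.
move=> ij; apply/eqP/negPn/negP => neq_ij.
have h01 : 0 < (2^-1 : R) < 1 by lra.
have hE : edge X i (chart X i 2^-1).
  by exists 2^-1 => //; rewrite /unit_interval /= in_itv /=; lra.
have hm := conj hE (ij _ hE) : (edge X i `&` edge X j) (chart X i 2^-1).
have nv := @edge_interior _ _ _ X i _ h01.
case: (edge_meet X neq_ij) => [|[v vV]|[v [w [vV wV]]]] E; move: hm; rewrite E.
- by [].
- by move=> /= hv; apply: nv; rewrite hv.
- by case=> /= hv; apply: nv; rewrite hv.
Qed.

Variable L : G -> G.

Lemma markov_gt0 (i j : 'I_e) :
  (0 < markov_matrix X L i j)%N -> edge X i `<=` L @` edge X j.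
Proof.
rewrite mxE.
(* [fset_set] sends an infinite set to the empty one, so a positive count yields a covering
   subinterval in any case. *)
have [fin|inf] := pselect (finite_set (covering_subintervals X L i j)); last first.
  by rewrite /fset_set; case: pselect => //; rewrite cardfs0.
rewrite cardfs_gt0 => /fset0Pn[ab].
rewrite in_fset_set // => /set_mem[a0 _ b1 [[_ _ surj] _ _]] y /surj[x [t tab <-] <-].
exists (chart X j t) => //; exists t => //; move: tab.
rewrite /unit_interval /= !in_itv /= => /andP[ta tb].
by rewrite (le_trans a0 ta) (le_trans tb b1).
Qed.

Lemma markov_exp_gt0 (k : nat) (i j : 'I_e) :
  (0 < (markov_matrix X L ^+ k) i j)%N -> edge X i `<=` iter k L @` edge X j.
Proof.
elim: k i => [|k IHk] i.
  rewrite expr0 mxE; case: eqP => // -> _ y yE; by exists y.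
rewrite exprS mxE lt0n sum_nat_eq0 negb_forall => /existsP[l].
rewrite /= -lt0n muln_gt0 => /andP[il /IHk lj] y /(markov_gt0 il)[z /lj[w wE <-] <-].
by exists w.
Qed.

(** A negative [r] encodes a tile traversed backwards. *)
Definition tile (n : nat) (j i : 'I_e) (c r : R) : Prop :=
  [/\ 0 <= c <= 1, 0 <= c + r <= 1 &
      forall s, 0 <= s <= 1 -> iter n L (chart X j (c + r * s)) = chart X i s].

Lemma tile_comp (n n' : nat) (j i i' : 'I_e) (c r c' r' : R) :
  tile n j i c r -> tile n' i i' c' r' ->
  tile (n' + n) j i' (c + r * c') (r * r').
Proof.
move=> [c01 cr01 H] [c01' cr01' H']; split; first exact: convex_unit.
  by rewrite -addrA -mulrDr; exact: convex_unit.
move=> s s01; rewrite -addrA -mulrA -mulrDr iterD H ?H' //.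
exact: convex_unit.
Qed.

(** Since [c] and [c + r] lie in [0, 1], [r] of absolute value 1 makes the tile the whole edge; as
    [r * r = 1], the point [t] has tile coordinate [r * (t - c)]. *)
Lemma tile_slope1 (n : nat) (j i : 'I_e) (c r : R) :
  tile n j i c r -> `|r| = 1 -> iter n L @` edge X j `<=` edge X i.
Proof.
move=> [/andP[c0 c1] /andP[cr0 cr1] H] r1 _ [_ [t t01 <-] <-].
move: t01; rewrite /unit_interval /= in_itv /= => /andP[t0 t1].
have rr : r * r = 1 by have := real_normK (num_real r); rewrite r1 !expr2; lra.
have {}t01 : 0 <= r * (t - c) <= 1.
  case: (ler0P r) r1 => [_ r1|_ r1].
    have -> : r = -1 by lra.
    by apply/andP; split; lra.
  by rewrite r1; apply/andP; split; lra.
exists (r * (t - c)); first by rewrite /unit_interval /= in_itv.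
by rewrite -H // mulrA rr mul1r addrC subrK.
Qed.

(** A collapsed edge keeps a one-point image, whereas an edge has two distinct ends. This rules out
    empty paths in the linearization. *)
Lemma iter_constant (n : nat) (i j : 'I_e) (y : G) :
  (0 < n)%N -> (forall x, edge X j x -> L x = y) ->
  ~ (edge X i `<=` iter n L @` edge X j).
Proof.
case: n => // n _ Ly sub; have [_ _ neq01] := edge_ends X i; apply: neq01.
have cst t : unit_interval R t -> chart X i t = iter n L y.
  move=> t01; have [|x xE] := sub (chart X i t); first by exists t.
  by rewrite iterSr Ly.
by rewrite !cst // /unit_interval /= in_itv /= ?lexx ?ler01.
Qed.

(** If the path of edge [j] has [m] darts, the tiles are the intervals from [k / m] to
    [(k + 1) / m], each mapped onto the [k]-th dart; their inverse slope [1 / m] is 1 or at most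
    1/2. *)
Lemma tile1_cover (f : G -> G) (j : 'I_e) (t : R) :
  linearization X f L ->
  (forall y, ~ (forall x, edge X j x -> L x = y)) -> 0 <= t <= 1 ->
  exists i c r s, [/\ tile 1 j i c r, `|r| = 1 \/ `|r| <= 2^-1,
    0 <= s <= 1 & t = c + r * s].
Proof.
move=> [_ /(_ j)[p]] /= [path_p _ _ Lp] ncst t01.
have p0 : (0 < size p)%N.
  rewrite lt0n; apply/negP => /eqP/size0nil p_nil.
  apply: (ncst (f (chart X j 0))) => _ [s s01 <-].
  by rewrite Lp // p_nil.
set m : R := (size p)%:R in Lp *.
have m0 : 0 < m by rewrite ltr0n.
have [|k kp tk] := @nat_interval_cover R _ (m * t) p0.
  by move/andP: t01 => [t0 t1]; rewrite mulr_ge0 ?ler_piMr // ltW.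
have km : k%:R + 1 <= m by rewrite natr1 ler_nat.
have k0 : (0 : R) <= k%:R by [].
pose d := nth (j, false) p k.
have Ld s : 0 <= s <= 1 -> L (chart X j (m^-1 * (k%:R + s))) = dart_at X d s.
  move=> /andP[s0 s1]; rewrite Lp /unit_interval /=.
    by rewrite /constant_speed mulrA divff ?gt_eqF // mul1r
      (travel_nat (j, false) path_p) // s0.
  by rewrite in_itv /= mulrC ler_pdivlMr // ler_pdivrMr // mul0r mul1r; lra.
have r_m : `|m^-1| = 1 \/ `|m^-1| <= 2^-1.
  rewrite ger0_norm ?invr_ge0 ?(ltW m0) //.
  have [m1|m1] := leqP 2 (size p).
    by right; rewrite lef_pV2 ?posrE // ler_nat.
  left; rewrite /m; suff -> : size p = 1%N by rewrite invr1.
  by apply/eqP; rewrite eqn_leq p0 -ltnS m1.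
have u01 s : 0 <= s <= 1 -> 0 <= m^-1 * (k%:R + s) <= 1.
  by move=> /andP[? ?]; rewrite mulrC ler_pdivlMr // ler_pdivrMr // mul0r mul1r; lra.
have tE : t = m^-1 * (k%:R + (m * t - k%:R)).
  by rewrite addrC subrK mulKf // gt_eqF.
case: (boolP d.2) => d2.
(* A backward dart is parametrized from the right end of its tile. *)
- exists d.1, (m^-1 * (k%:R + 1)), (- m^-1), (1 - (m * t - k%:R)).
  rewrite normrN; split=> //; last 2 first.
  + by lra.
  + by rewrite [LHS]tE; ring.
  split; first by apply: u01; rewrite ler01 lexx.
    by have := u01 0; rewrite lexx ler01 addr0 mulrDr mulr1 addrK => /(_ isT).
  move=> s /andP[s0 s1] /=.
  have -> : m^-1 * (k%:R + 1) + - m^-1 * s = m^-1 * (k%:R + (1 - s)) by ring.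
  by rewrite Ld /dart_at ?d2 ?subKr //; lra.
- exists d.1, (m^-1 * k%:R), m^-1, (m * t - k%:R).
  split=> //; last by rewrite -mulrDr.
  split; first by have := u01 0; rewrite lexx ler01 addr0 => /(_ isT).
    by rewrite -[X in _ + X]mulr1 -mulrDr; apply: u01; rewrite ler01 lexx.
  by move=> s s01 /=; rewrite -mulrDr Ld // /dart_at (negbTE d2).
Qed.

(** Tiles compose and their slopes multiply; products of numbers that are 1 or in [0, 1/2] are again
    of this kind. *)
Lemma tile_cover (f : G -> G) (n : nat) (j : 'I_e) (t : R) :
  linearization X f L ->
  (forall j y, ~ (forall x, edge X j x -> L x = y)) -> 0 <= t <= 1 ->
  exists i c r s, [/\ tile n j i c r, `|r| = 1 \/ `|r| <= 2^-1,
    0 <= s <= 1 & t = c + r * s].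
Proof.
move=> linL ncst; elim: n j t => [|n IHn] j t t01.
  exists j, 0, 1, t; rewrite normr1 mul1r add0r; split=> //; last by left.
  by split=> [||s s01]; rewrite ?add0r ?mul1r ?lexx ?ler01.
have [i [c [r [s [T rle s01 tE]]]]] := tile1_cover linL (ncst j) t01.
have [i' [c' [r' [s' [T' rle' s01' sE]]]]] := IHn i s s01.
exists i', (c + r * c'), (r * r'), s'; split=> //.
- by rewrite -addn1; exact: tile_comp T T'.
- rewrite normrM; have := normr_ge0 r; have := normr_ge0 r'.
  case: rle rle' => [->|rle] [->|rle'] r0' r0; rewrite ?mul1r ?mulr1.
  + by left.
  + by right.
  + by right.
  + by right; nra.
- by rewrite tE sE; ring.
Qed.

End Mixing.

Theorem theorem7 (R : realType) (G : topologicalType) (e : nat)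
    (X : topgraph R G e) (f L : G -> G) :
  (1 < e)%N ->
  vertex_map X f ->
  linearization X f L ->
  primitive (markov_matrix X L) ->
  topologically_mixing L.
Proof.
Local Open Scope classical_set_scope.
Local Open Scope ring_scope.
move=> e1 _ linL [N N0 MN].
have spread k i j : (N <= k)%N -> edge X i `<=` iter k L @` edge X j.
  by move=> Nk; apply: markov_exp_gt0; exact: MN.
have e0 : (0 < e)%N by exact: ltnW.
have ncst (j : 'I_e) y : ~ (forall x, edge X j x -> L x = y).
  by move=> Ly; exact: (iter_constant (i := j) N0 Ly (spread _ _ _ (leqnn N))).
(* Otherwise the image of edge [j] under [L ^ N], which contains every edge, would lie in edge [i],
   and all edges would coincide. *)
have slope j i c r : tile X L N j i c r -> `|r| <> 1.
  move=> T r1; have all_i i' : i' = i.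
    apply: (@edge_subset _ _ _ X) => x /(spread _ _ j (leqnn N)).
    exact: tile_slope1 T r1 _.
  by have := congr1 val (etrans (all_i (Ordinal e0)) (esym (all_i (Ordinal e1)))).
(* Each block of [N] iterates contributes a factor of at most 1/2. *)
have small q j t : 0 <= t <= 1 -> exists i c r s,
    [/\ tile X L (q * N) j i c r, `|r| <= 2 ^- q, 0 <= s <= 1 & t = c + r * s].
  elim: q j t => [|q IHq] j t t01.
    exists j, 0, 1, t; rewrite normr1 mul1r add0r expr0 invr1; split=> //.
    by split=> [||s s01]; rewrite ?add0r ?mul1r ?lexx ?ler01.
  have [i [c [r [s [T rle s01 tE]]]]] := tile_cover N j linL ncst t01.
  have [i' [c' [r' [s' [T' rle' s01' sE]]]]] := IHq i s s01.
  exists i', (c + r * c'), (r * r'), s'; split=> //.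
  - by rewrite mulSn addnC; exact: tile_comp T T'.
  - rewrite normrM exprS invfM ler_pM //.
    by case: rle => // r1; case: (slope _ _ _ _ T).
  - by rewrite tE sE; ring.
move=> U V oU oV [x Ux] [y Vy].
have [j _ [t t01 xE]] : (\bigcup_i edge X i) x by rewrite bigcup_edge.
have [i' _ yi'] : (\bigcup_i edge X i) y by rewrite bigcup_edge.
have [_ chart_cont _] := chart_homeo X j.
(* The chart is continuous only within [0, 1], so the neighborhood of [t] is relative to it. *)
have : \forall s \near t, unit_interval R s -> U (chart X j s).
  have : nbhs (chart X j t) U by apply: open_nbhs_nbhs; rewrite xE.
  by move/(chart_cont t); rewrite /= /nbhs /= -(nbhs_subspace_in t01).
move=> [eps /= eps0 epsU].
have [q _ /(_ q (leqnn q))] := near_infty_natSinv_expn_lt (PosNum eps0).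
rewrite /= div1r => qeps.
have t01' : 0 <= t <= 1 by move: t01; rewrite /unit_interval /= in_itv.
have [i [c [r [s [[c01 cr01 T] rle s01 tE]]]]] := small q j t t01'.
(* The first [q * N] iterates stretch the tile around [t] onto edge [i]; at least [N] iterates
   remain to carry edge [i] over [y]. *)
exists (N + q * N)%N; first by rewrite addn_gt0 N0.
move=> k Nk; have qk : (q * N <= k)%N by exact: leq_trans (leq_addl _ _) Nk.
have [|_ [s' s'01 <-] yE] := spread (k - q * N)%N i' i _ y yi'.
  by rewrite leq_subRL // addnC.
exists y; split=> //; move: s'01; rewrite /unit_interval /= in_itv /= => s'01.
(* This point of the tile is sent by [L ^ (q * N)] to [chart X i s']; its parameter is within
   [2 ^- q < eps] of [t]. *)
exists (chart X j (c + r * s')); last first.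
  by rewrite -{1}(subnK qk) iterD T.
apply: epsU; last by rewrite /unit_interval /= in_itv /=; exact: convex_unit.
rewrite /= tE; apply: le_lt_trans qeps; apply: le_trans rle.
have -> : c + r * s - (c + r * s') = r * (s - s') by ring.
rewrite normrM ler_piMr // ler_norml; lra.
Qed.
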